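(* Let $\mathbb{F}$ be an algebraically closed field of characteristic 0, and let $i\in\mathbb{F}$ satisfy $i^2=-1$. Let $\mathcal{Q}=\mathcal{O}/(R)$, $R\subseteq\mathcal{O}(2)$, be a quadratic nonsymmetric operad with two associative binary operations $\vdash,\dashv$ (that is, $A\subseteq R$). Then $\mathcal{Q}$ is self-dual if and only if its relation matrix $[R]$ is one of the following: $$\begin{bmatrix}1&0&0&0&-1&0&0&0\\0&1&0&0&0&\pm\lambda&\pm\sqrt{1-\lambda^2}&0\\0&0&1&0&0&\pm\sqrt{1-\lambda^2}&\lambda&0\\0&0&0&1&0&0&0&-1\end{bmatrix}\quad(\lambda\in\mathbb{F}),\qquad\begin{bmatrix}1&0&0&0&-1&0&0&0\\0&1&\pm i&0&0&0&0&0\\0&0&0&1&0&0&0&-1\\0&0&0&0&0&1&\pm i&0\end{bmatrix},$$ where in each matrix the signs $\pm$ may be chosen independently.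
   Context: $\mathcal{O}$ is the free nonsymmetric operad over $\mathbb{F}$ generated by two binary operations $\vdash,\dashv$ (no symmetry or associativity assumed), graded by weight $w$ (number of operations). Its weight-2 component $\mathcal{O}(2)$ has dimension 8 with ordered basis $(-\vdash-)\vdash-$, $(-\vdash-)\dashv-$, $(-\dashv-)\vdash-$, $(-\dashv-)\dashv-$, $-\vdash(-\vdash-)$, $-\vdash(-\dashv-)$, $-\dashv(-\vdash-)$, $-\dashv(-\dashv-)$. Identify $\mathcal{O}(2)$ with $\mathbb{F}^8$ using this basis. Let $\langle-,-\rangle$ be the symmetric bilinear form on $\mathcal{O}(2)$ for which this basis is orthogonal, the first four basis elements have $\langle m,m\rangle=1$, and the last four have $\langle m,m\rangle=-1$. For a subspace $R\subseteq\mathcal{O}(2)$, $R^\pm$ denotes its orthogonal complement with respect to $\langle-,-\rangle$, and $(R)$ the operad ideal generated by $R$. The Koszul dual of $\mathcal{Q}=\mathcal{O}/(R)$ is $\mathcal{Q}^!=\mathcal{O}/(R^\pm)$, and $\mathcal{Q}$ is self-dual if $\mathcal{Q}=\mathcal{Q}^!$, equivalently $R=R^\pm$. The relation matrix $[R]$ of $\mathcal{O}/(R)$ is the unique full-rank matrix with 8 columns in reduced row echelon form whose row space is $R$; $\sqrt{1-\lambda^2}$ denotes a square root of $1-\lambda^2$ in $\mathbb{F}$. $A\subset\mathcal{O}(2)$ is the 2-dimensional subspace spanned by the two associativity relations $(-\vdash-)\vdash- \;-\; -\vdash(-\vdash-)$ and $(-\dashv-)\dashv- \;-\; -\dashv(-\dashv-)$,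 i.e. by the vectors $(1,0,0,0,-1,0,0,0)$ and $(0,0,0,1,0,0,0,-1)$. The operations of $\mathcal{O}/(R)$ are associative if and only if $A\subseteq R$.
   Formalization: In the first matrix the signs are not independent: an odd number of the three ± must be minus, since otherwise rows 2 and 3 are not orthogonal when λ√(1−λ²) ≠ 0 (e.g. λ = 3/5, all signs plus), and R is not self-dual. *)

(* Defs.v *)
From HB Require Import structures.
From mathcomp Require Import all_boot all_order all_algebra finmap.
From mathcomp.multinomials Require Import monalg.

Set Implicit Arguments.
Unset Strict Implicit.
Unset Printing Implicit Defensive.

Import GRing.Theory.

(* Tree monomials of the free nonsymmetric operad on two binary operations:
   [Node o l r] is the monomial (l o r). *)
Inductive binop : Type := Vdash | Dashv.

Inductive tree : Type := Leaf | Node of binop & tree & tree.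

Definition bool_of_binop (o : binop) : bool := if o is Vdash then false else true.

Fixpoint encode_tree (t : tree) : GenTree.tree void :=
  if t is Node o l r
  then GenTree.Node (bool_of_binop o).+1 [:: encode_tree l; encode_tree r]
  else GenTree.Node 0 [::].

Fixpoint decode_tree (c : GenTree.tree void) : option tree :=
  match c with
  | GenTree.Node 0 [::] => Some Leaf
  | GenTree.Node k.+1 [:: a; b] =>
      if decode_tree a is Some l then
        if decode_tree b is Some r then
          Some (Node (if k is 0 then Vdash else Dashv) l r)
        else None
      else None
  | _ => None
  end.

Lemma encode_treeK : pcancel encode_tree decode_tree.
Proof. by elim=> [|[] l IHl r IHr] //=; rewrite IHl IHr. Qed.

HB.instance Definition _ := Choice.copy tree (pcan_type encode_treeK).

(* The weight is the number of operations; a tree of weight w has w.+1 leaves. *)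
Fixpoint weight (t : tree) : nat :=
  if t is Node _ l r then (weight l + weight r).+1 else 0.

(* Substitute s for the i-th leaf of t, leaves being numbered from 0 from left
   to right. *)
Fixpoint graft (t : tree) (i : nat) (s : tree) : tree :=
  if t is Node o l r then
    if i < (weight l).+1 then Node o (graft l i s) r
    else Node o l (graft r (i - (weight l).+1) s)
  else s.

Lemma weight_graft t i s : weight (graft t i s) = (weight t + weight s)%N.
Proof.
elim: t i => [|o l IHl r IHr] i //=; case: ifP => _ /=; rewrite ?IHl ?IHr.
  by rewrite addSn addnAC.
by rewrite addSn addnA.
Qed.

Record wtree (w : nat) : Type := WTree { wtree_val :> tree; _ : weight wtree_val == w }.
HB.instance Definition _ w := [isSub for @wtree_val w].
HB.instance Definition _ w := [Choice of wtree w by <:].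

Lemma wgraft_subproof w1 w2 (t : wtree w1) (i : nat) (s : wtree w2) :
  weight (graft t i s) == (w1 + w2)%N.
Proof. by rewrite weight_graft (eqP (valP t)) (eqP (valP s)). Qed.

Definition wgraft w1 w2 (t : wtree w1) (i : nat) (s : wtree w2) : wtree (w1 + w2) :=
  WTree (wgraft_subproof t i s).

Local Open Scope ring_scope.

(* The component of weight w, that is, of arity w.+1. *)
Notation freeop F w := {malg F[wtree w]}.

Section FreeOperad.
Variable F : fieldType.

Definition opcomp w1 w2 (f : freeop F w1) (i : 'I_w1.+1) (g : freeop F w2) :
    freeop F (w1 + w2) :=
  \sum_(t <- msupp f) \sum_(s <- msupp g) << f@_t * g@_s *g wgraft t i s >>.

Definition subspaces (I : forall w, freeop F w -> Prop) : Prop :=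
  forall w, I w 0 /\ forall (a : F) (f g : freeop F w), I w f -> I w g -> I w (a *: f + g).

Definition operad_ideal (I : forall w, freeop F w -> Prop) : Prop :=
  subspaces I /\
  forall w1 w2 (f : freeop F w1) (i : 'I_w1.+1) (g : freeop F w2),
    I w1 f \/ I w2 g -> I (w1 + w2)%N (opcomp f i g).

(* ((-a-)b-) and (-a(-b-)) *)
Definition lmon (a b : binop) : wtree 2 :=
  @WTree 2 (Node b (Node a Leaf Leaf) Leaf) isT.
Definition rmon (a b : binop) : wtree 2 :=
  @WTree 2 (Node a Leaf (Node b Leaf Leaf)) isT.

Definition quadmon : 8.-tuple (wtree 2) :=
  [tuple lmon Vdash Vdash; lmon Vdash Dashv; lmon Dashv Vdash; lmon Dashv Dashv;
         rmon Vdash Vdash; rmon Vdash Dashv; rmon Dashv Vdash; rmon Dashv Dashv].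

(* The identification of F^8 with the component of weight 2. *)
Definition quadelt (v : 'rV[F]_8) : freeop F 2 :=
  \sum_(k < 8) << v 0 k *g tnth quadmon k >>.

Definition ideal_gen (R : {vspace 'rV[F]_8}) (w : nat) (f : freeop F w) : Prop :=
  forall I : (forall w, freeop F w -> Prop),
    operad_ideal I -> (forall v, v \in R -> I 2 (quadelt v)) -> I w f.

(* Equality of f and g in the quotient of the free operad by the ideal (R).
   The quotient is represented by this congruence: two quotients of the free
   operad are equal when they identify the same elements. *)
Definition quot_eq (R : {vspace 'rV[F]_8}) (w : nat) (f g : freeop F w) : Prop :=
  ideal_gen R (f - g).

Definition pmform (u v : 'rV[F]_8) : F :=
  \sum_(k < 8) (if (k < 4)%N then 1 else -1) * (u 0 k * v 0 k).

Fact pmform_bilinear :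
  bilinear_for (GRing.Scale.Law.clone _ _ *%R _)
               (GRing.Scale.Law.clone _ _ (idfun \; *%R) _) pmform.
Proof.
split=> w a u v /=; rewrite /pmform mulr_sumr -big_split; apply: eq_bigr => k _;
  rewrite !mxE.
  by rewrite mulrDl mulrDr -(mulrA a) (mulrCA _ a).
by rewrite (mulrDr (w 0 k)) mulrDr (mulrCA _ a) (mulrCA _ a).
Qed.

HB.instance Definition _ :=
  bilinear_isBilinear.Build F 'rV[F]_8 'rV[F]_8 F _ _ pmform pmform_bilinear.

Fact pmform_sym u v : pmform u v = (-1) ^+ false * idfun (pmform v u).
Proof.
by rewrite mul1r; apply: eq_bigr => k _; congr (_ * _); rewrite mulrC.
Qed.

HB.instance Definition _ :=
  isHermitianSesquilinear.Build F 'rV[F]_8 false idfun pmform pmform_sym.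

Definition pmorth (R : {vspace 'rV[F]_8}) : {vspace 'rV[F]_8} := orthov pmform R.

Lemma pmorthP (R : {vspace 'rV[F]_8}) (v : 'rV[F]_8) :
  reflect (forall u, u \in R -> pmform v u = 0) (v \in pmorth R).
Proof. exact: mem_orthovP. Qed.

(* The quadratic operad presented by R equals its Koszul dual, the quadratic
   operad presented by the orthogonal complement of R. *)
Definition self_dual (R : {vspace 'rV[F]_8}) : Prop :=
  forall w (f g : freeop F w), quot_eq R f g <-> quot_eq (pmorth R) f g.

Definition row8 (s : seq F) : 'rV[F]_8 := \row_j s`_j.

Definition assoc_vdash : 'rV[F]_8 := row8 [:: 1; 0; 0; 0; -1; 0; 0; 0].
Definition assoc_dashv : 'rV[F]_8 := row8 [:: 0; 0; 0; 1; 0; 0; 0; -1].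

Definition assoc_rels : {vspace 'rV[F]_8} := <<[:: assoc_vdash; assoc_dashv]>>%VS.

Definition leading m n (M : 'M[F]_(m, n)) (i : 'I_m) (j : 'I_n) : Prop :=
  M i j != 0 /\ forall k : 'I_n, (k < j)%N -> M i k = 0.

Definition is_rref m n (M : 'M[F]_(m, n)) : Prop :=
  [/\ forall i i' : 'I_m, (i < i')%N -> row i M = 0 -> row i' M = 0,
      forall (i i' : 'I_m) (j j' : 'I_n), (i < i')%N ->
        leading M i j -> leading M i' j' -> (j < j')%N,
      forall i j, leading M i j -> M i j = 1
    & forall i i' j, leading M i j -> i' != i -> M i' j = 0].

(* M is the relation matrix of R. *)
Definition relation_matrix m (R : {vspace 'rV[F]_8}) (M : 'M[F]_(m, 8)) : Prop :=
  [/\ row_free M, is_rref M & forall v : 'rV[F]_8, (v <= M)%MS = (v \in R)].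

Definition mx48 (s : seq (seq F)) : 'M[F]_(4, 8) := \matrix_(i, j) (nth [::] s i)`_j.

(* The signs of both families are booleans, true standing for minus; mu is a
   square root of 1 - lam ^+ 2.  Rows 1 and 2 (from 0) of orthogonal_mx pair to
   - ((-1) ^+ (s1 + s3) + (-1) ^+ s2) * (lam * mu), so that unless lam * mu = 0
   its row space is isotropic only when an odd number of the signs are minus. *)
Definition orthogonal_mx (lam mu : F) (s1 s2 s3 : bool) : 'M[F]_(4, 8) := mx48
  [:: [:: 1; 0; 0; 0; -1;                0;              0;  0];
      [:: 0; 1; 0; 0;  0; (-1) ^+ s1 * lam; (-1) ^+ s2 * mu;  0];
      [:: 0; 0; 1; 0;  0; (-1) ^+ s3 * mu;              lam;  0];
      [:: 0; 0; 0; 1;  0;                0;              0; -1]].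

Definition isotropic_mx (im : F) (s1 s2 : bool) : 'M[F]_(4, 8) := mx48
  [:: [:: 1; 0;               0; 0; -1; 0;               0;  0];
      [:: 0; 1; (-1) ^+ s1 * im; 0;  0; 0;               0;  0];
      [:: 0; 0;               0; 1;  0; 0;               0; -1];
      [:: 0; 0;               0; 0;  0; 1; (-1) ^+ s2 * im;  0]].

End FreeOperad.

(* Main.v *)
(* Truncating the free operad shows that the ideal (R) meets weight 2 exactly in
   R, so that the operad is self-dual if and only if R equals its orthogonal
   complement.  Such an R is 4-dimensional, and when it contains the two
   associativity relations it is determined by a totally isotropic plane for the
   form x1^2 + x2^2 - x5^2 - x6^2.  If the plane projects isomorphically onto the
   coordinates (x1, x2), it is the graph of an orthogonal 2x2 matrix.  Otherwise
   it contains a null vector (0, 0, 1, +-i), and then, being its own orthogonal,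
   also a vector (1, +-i, 0, 0). *)

From HB Require Import structures.
Require Import Defs.
From mathcomp Require Import all_boot all_order all_algebra.
From mathcomp Require Import finmap ring.
From mathcomp.multinomials Require Import monalg.

Set Implicit Arguments.
Unset Strict Implicit.
Unset Printing Implicit Defensive.

Import GRing.Theory.
Local Open Scope ring_scope.

(** * The weight-2 part of the ideal generated by R *)

Section QuadraticPart.
Variable F : fieldType.
Implicit Types R : {vspace 'rV[F]_8}.

Lemma tnth_quadmon_inj : injective (tnth quadmon).
Proof. by apply/tuple_uniqP; vm_compute. Qed.

Lemma mcoeff_quadelt (v : 'rV[F]_8) k : (quadelt v)@_(tnth quadmon k) = v 0 k.
Proof.
rewrite /quadelt raddf_sum (bigD1 k) //= mcoeffUU big1 ?addr0 // => j neq_jk.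
by rewrite mcoeffU (inj_eq tnth_quadmon_inj) (negPf neq_jk).
Qed.

Lemma quadelt_inj : injective (@quadelt F).
Proof.
by move=> u v eq_uv; apply/rowP => k; rewrite -!mcoeff_quadelt eq_uv.
Qed.

Lemma quadelt_is_linear : linear (@quadelt F).
Proof.
move=> a u v; rewrite /quadelt scaler_sumr -big_split /=; apply: eq_bigr => k _.
apply/malgP => t; rewrite mcoeffD mcoeffZ !mcoeffU !mxE.
by case: eqP; rewrite ?mulr1n // !mulr0n mulr0 addr0.
Qed.

HB.instance Definition _ :=
  GRing.isLinear.Build F 'rV[F]_8 (freeop F 2) _ (@quadelt F) quadelt_is_linear.

(* The family that is zero in weights 0 and 1, R in weight 2 and everything
   above is an ideal, so that (R) has no elements of weight 2 besides R. *)
Definition truncated_ideal R (w : nat) : freeop F w -> Prop :=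
  match w return freeop F w -> Prop with
  | 0 | 1 => fun f => f = 0
  | 2 => fun f => exists2 v, v \in R & f = quadelt v
  | _ => fun _ => True
  end.

Lemma opcomp0l w1 w2 i (g : freeop F w2) : opcomp (0 : freeop F w1) i g = 0.
Proof. by rewrite /opcomp msupp0 big_seq_fset0. Qed.

Lemma opcomp0r w1 w2 (f : freeop F w1) i : opcomp f i (0 : freeop F w2) = 0.
Proof. by rewrite /opcomp msupp0 big1 // => t _; rewrite big_seq_fset0. Qed.

Lemma weight0_leaf (t : wtree 0) : wtree_val t = Leaf.
Proof. by case: t => -[]. Qed.

Lemma graft_leaf t i : (i < (weight t).+1)%N -> graft t i Leaf = t.
Proof.
elim: t i => [|o l IHl r IHr] i //=; case: ifP => [lt_i _|ge_i lt_i].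
  by rewrite IHl.
rewrite IHr // ltn_subLR; last by rewrite leqNgt ge_i.
by rewrite addSn addnS.
Qed.

(** The leaf is the only tree of weight 0 and grafting treats it as a unit, so an element of weight
    0 acts as a scalar. *)
Lemma opcomp_scalarl w (f : freeop F 0) i (g : freeop F w) :
  opcomp f i g = (\sum_(t <- msupp f) f@_t) *: (g : freeop F (0 + w)).
Proof.
rewrite /opcomp scaler_suml; apply: eq_bigr => t _.
rewrite [in RHS](monalgE g) scaler_sumr; apply: eq_bigr => s _.
have -> : wgraft t i s = s by apply: val_inj; rewrite /= weight0_leaf.
by apply/malgP => u; rewrite mcoeffZ !mcoeffU mulrnAr.
Qed.

(** Stated in weight 2 rather than a variable weight, because [2 + 0] reduces to [2] and the two
    sides have convertible types. *)
Lemma opcomp_scalarr (f : freeop F 2) i (g : freeop F 0) :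
  opcomp f i g = (\sum_(s <- msupp g) g@_s) *: (f : freeop F (2 + 0)).
Proof.
rewrite /opcomp exchange_big scaler_suml; apply: eq_bigr => s _.
rewrite [in RHS](monalgE f) scaler_sumr; apply: eq_bigr => t _.
have -> : wgraft t i s = t.
  apply: val_inj => /=; rewrite weight0_leaf graft_leaf // (eqP (valP t)).
  exact: ltn_ord.
by apply/malgP => u; rewrite mcoeffZ !mcoeffU mulrC mulrnAr.
Qed.

Lemma truncated_idealP R : operad_ideal (truncated_ideal R).
Proof.
have zero_mem : exists2 v, v \in R & 0 = quadelt v.
  by exists 0; rewrite ?mem0v ?linear0.
have scale_mem a f : (exists2 v, v \in R & f = quadelt v) ->
    exists2 v, v \in R & a *: f = quadelt v.
  by case=> v Rv ->; exists (a *: v); rewrite ?memvZ ?linearZ.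
split=> [[|[|[|w]]]|] //=; try by split=> // a f g -> ->; rewrite scaler0 addr0.
  split=> // a _ _ [u Ru ->] [v Rv ->].
  by exists (a *: u + v); rewrite ?memvD ?memvZ ?linearP.
(* Weights add, so only the pairs of total weight at most 2 remain. In each, either a factor is
   zero, or a factor from R is composed with a scalar of weight 0. *)
move=> [|[|[|w1]]] [|[|[|w2]]] f i g //=.
- by case=> ->; rewrite ?opcomp0l ?opcomp0r.
- by case=> ->; rewrite ?opcomp0l ?opcomp0r.
- case=> [->|Rg]; first by rewrite opcomp0l.
  by rewrite opcomp_scalarl; apply: scale_mem.
- by case=> ->; rewrite ?opcomp0l ?opcomp0r.
- by case=> ->; rewrite ?opcomp0l ?opcomp0r.
- case=> [Rf|->]; last by rewrite opcomp0r.
  by rewrite opcomp_scalarr; apply: scale_mem.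
Qed.

Lemma ideal_gen_quadelt R v : ideal_gen R (quadelt v) <-> v \in R.
Proof.
split=> [genv|Rv I _]; last exact.
have [|u Ru] := genv _ (truncated_idealP R).
  by move=> u Ru; exists u.
by move/quadelt_inj->.
Qed.

Lemma self_dualE R : self_dual R <-> pmorth R = R.
Proof.
split=> [sdR|eqR]; last by rewrite /self_dual eqR.
(* Comparing [quadelt v] with 0 in weight 2 recovers the relation space from its congruence. *)
apply/vspaceP => v; have := sdR 2 (quadelt v) 0.
rewrite /quot_eq subr0 => -[genR genRo].
by apply/idP/idP => /ideal_gen_quadelt ?; apply/ideal_gen_quadelt; auto.
Qed.

End QuadraticPart.

(** * Echelon form from prescribed pivot columns *)

Section Pivots.
Variables (F : fieldType) (m n : nat) (M : 'M[F]_(m, n)) (piv : 'I_m -> 'I_n).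
Hypothesis piv_mono : forall i i' : 'I_m, (i < i')%N -> (piv i < piv i')%N.
Hypothesis M_piv : forall i i' : 'I_m, M i (piv i') = (i == i')%:R.
Hypothesis M_lt_piv : forall i (k : 'I_n), (k < piv i)%N -> M i k = 0.

Lemma pivots_row_free : row_free M.
Proof.
(* Selecting the pivot columns turns [M] into the identity, so the selection matrix is a right
   inverse. *)
apply/row_freeP; exists (\matrix_(k, i) (k == piv i)%:R).
apply/matrixP => i i'; rewrite !mxE (bigD1 (piv i')) //= big1 => [|k neq_k].
  by rewrite mxE eqxx mulr1 addr0 M_piv.
by rewrite mxE (negPf neq_k) mulr0.
Qed.

Lemma leading_pivot i j : leading M i j -> j = piv i.
Proof.
case=> nz_ij zero_lt; apply: val_inj.
case: (ltngtP j (piv i)) => // [lt_j|/zero_lt].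
  by rewrite M_lt_piv ?eqxx in nz_ij.
by move/eqP; rewrite M_piv eqxx oner_eq0.
Qed.

Lemma pivots_rref : is_rref M.
Proof.
split=> [i i' _ /rowP/(_ (piv i))|i i' j j' lt_ii'|i j|i i' j].
- by move/eqP; rewrite !mxE M_piv eqxx oner_eq0.
- by move=> /leading_pivot-> /leading_pivot->; apply: piv_mono.
- by move/leading_pivot->; rewrite M_piv eqxx.
- by move/leading_pivot-> => /negPf neq; rewrite M_piv neq.
Qed.

End Pivots.

(** * Orthogonal complements through the Gram matrix *)

Section Isotropic.
Variable F : fieldType.
Implicit Types (R : {vspace 'rV[F]_8}) (u v : 'rV[F]_8).

Definition gram : 'M[F]_8 := diag_mx (\row_k if (k < 4)%N then 1 else -1).

Lemma pmformE u v : pmform u v = (u *m gram *m v^T) 0 0.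
Proof.
rewrite /pmform /gram mul_mx_diag mxE; apply: eq_bigr => k _.
by rewrite !mxE mulrCA mulrA.
Qed.

Lemma gram_unit : gram \in unitmx.
Proof.
rewrite unitmxE det_diag unitfE; apply/prodf_neq0 => k _; rewrite mxE.
by case: ifP => _; rewrite ?oppr_eq0 oner_eq0.
Qed.

Lemma pmorth_kermx m (B : 'M[F]_(m, 8)) R :
    (forall v, (v <= B)%MS = (v \in R)) ->
  forall v, (v <= kermx (gram *m B^T))%MS = (v \in pmorth R).
Proof.
move=> defR v; apply/sub_kermxP/pmorthP => [vB0 u|vR0].
  rewrite -defR => /submxP[w ->].
  by rewrite pmformE trmx_mul mulmxA -(mulmxA v) vB0 mul0mx mxE.
apply/rowP => i; rewrite mulmxA [RHS]mxE.
have := vR0 (row i B); rewrite -defR row_sub => /(_ isT) <-.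
by rewrite pmformE !mxE; apply: eq_bigr => k _; rewrite !mxE.
Qed.

Lemma kermx_gram_rank m (B : 'M[F]_(m, 8)) :
  \rank (kermx (gram *m B^T)) = (8 - \rank B)%N.
Proof.
rewrite mxrank_ker -mxrank_tr trmx_mul trmxK mxrankMfree //.
by rewrite row_free_unit unitmx_tr gram_unit.
Qed.

(** The form is nondegenerate, so a 4-dimensional space has an orthogonal complement of dimension 8
    - 4 = 4; containment is then equality. *)
Lemma isotropic_kermx (M : 'M[F]_(4, 8)) :
    row_free M -> (M <= kermx (gram *m M^T))%MS ->
  (M :=: kermx (gram *m M^T))%MS.
Proof.
move=> /eqP rankM isoM; apply/eqmxP.
by rewrite -(mxrank_leqif_eq isoM) kermx_gram_rank rankM.
Qed.

Lemma isotropic_self_orth (M : 'M[F]_(4, 8)) R :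
    row_free M -> (forall v, (v <= M)%MS = (v \in R)) ->
    (forall i j, pmform (row i M) (row j M) = 0) ->
  pmorth R = R.
Proof.
move=> freeM defR isoM; apply/vspaceP => v; rewrite -(pmorth_kermx defR) -defR.
suff /(isotropic_kermx freeM) <- : (M <= kermx (gram *m M^T))%MS by [].
apply/row_subP => i; rewrite (pmorth_kermx defR); apply/pmorthP => u.
rewrite -defR => /submxP[w ->]; rewrite mulmx_sum_row linear_sumr big1 // => j _.
by rewrite linearZr /= isoM mulr0.
Qed.

(** The row space of [M] lies in R, which is isotropic, so it is its own complement; hence R, being
    orthogonal to every row of [M], lies in the row space. *)
Lemma self_orth_span (M : 'M[F]_(4, 8)) R :
    pmorth R = R -> row_free M -> (forall i, row i M \in R) ->
  forall v, (v <= M)%MS = (v \in R).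
Proof.
move=> orthR freeM RM.
have sMR v : (v <= M)%MS -> v \in R.
  case/submxP=> w ->; rewrite mulmx_sum_row; apply: memv_suml => i _.
  exact/memvZ/RM.
have sRker v : v \in R -> (v <= kermx (gram *m M^T))%MS.
  move=> Rv; apply/sub_kermxP/rowP => i; rewrite [RHS]mxE mulmxA.
  have /pmorthP/(_ _ (RM i)) : v \in pmorth R by rewrite orthR.
  move=> <-; rewrite pmformE !mxE.
  by apply: eq_bigr => k _; rewrite !mxE.
move=> v; apply/idP/idP => [/sMR//|/sRker].
suff /(isotropic_kermx freeM) <- : (M <= kermx (gram *m M^T))%MS by [].
by apply/row_subP => i; apply: sRker.
Qed.

Lemma vspace_row_span R :
  exists B : 'M[F]_(\dim R, 8), forall v, (v <= B)%MS = (v \in R).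
Proof.
exists (\matrix_i (vbasis R)`_i) => v; apply/submxP/idP => [[w ->]|Rv].
  rewrite mulmx_sum_row; apply: memv_suml => i _; rewrite rowK memvZ //.
  by rewrite vbasis_mem ?mem_nth ?size_tuple.
exists (\row_i coord (vbasis R) i v).
rewrite {1}(coord_vbasis Rv) mulmx_sum_row; apply: eq_bigr => i _.
by rewrite rowK mxE.
Qed.

(** Since R has dimension 4, its projection to the first four coordinates is either not injective or
    surjective. *)
Lemma self_orth_first_half R : pmorth R = R ->
  (exists2 v, v \in R & v != 0 /\ forall k : 'I_8, (k < 4)%N -> v 0 k = 0) \/
  (forall w : 'rV[F]_4, exists2 v, v \in R & forall j, v 0 (@lshift 4 4 j) = w 0 j).
Proof.
move=> orthR; have [B defR] := vspace_row_span R.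
have rankB : \rank B = 4.
  have /eqmx_rank : (B == kermx (gram *m B^T))%MS.
    by apply/andP; split; apply/rV_subP => v; rewrite (pmorth_kermx defR) defR orthR.
  (* The rank r satisfies r = 8 - r; running through r = 0, ..., 8 leaves only 4. *)
  rewrite kermx_gram_rank; have := rank_leq_col B.
  by move: (\rank B); do 9!case=> //.
(* Right multiplication by [P] is the projection to the first four coordinates. *)
pose P : 'M[F]_(4 + 4, 4) := col_mx 1%:M 0.
have mulP (v : 'rV[F]_(4 + 4)) : v *m P = lsubmx v.
  by rewrite -{1}[v]hsubmxK mul_row_col mulmx1 mulmx0 addr0.
have [BP0|/rowV0Pn[v]] := eqVneq (B :&: kermx P)%MS 0; last first.
  rewrite sub_capmx defR => /andP[Rv /sub_kermxP vP0] v_neq0.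
  left; exists v => //; split=> // k lt_k4.
  have /rowP/(_ (Ordinal lt_k4)) : v *m P = 0 := vP0.
  by rewrite mulP !mxE => <-; congr (v _ _); apply: val_inj.
right=> w.
have /row_fullP[U UBP] : row_full (B *m P).
  by have := mxrank_mul_ker B P; rewrite BP0 mxrank0 addn0 rankB => /eqP.
exists (w *m U *m B) => [|j]; first by rewrite -defR submxMl.
have /rowP/(_ j) : w *m U *m B *m P = w by rewrite -!mulmxA UBP mulmx1.
by rewrite mulP mxE.
Qed.

End Isotropic.

(** * Reduction to the four middle coordinates *)

Section Classification.
Variable F : fieldType.
Implicit Types (R : {vspace 'rV[F]_8}).

(* The coordinates that survive in the orthogonal complement of the two
   associativity relations, modulo those relations. *)
Definition mid (a b c d : F) : 'rV[F]_8 := row8 [:: 0; a; b; 0; 0; c; d; 0].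

Lemma row8P (u v : 'rV[F]_8) : let c (w : 'rV[F]_8) (k : nat) : F := w 0 (inord k) in
  c u 0%N = c v 0%N -> c u 1%N = c v 1%N -> c u 2%N = c v 2%N -> c u 3%N = c v 3%N ->
  c u 4%N = c v 4%N -> c u 5%N = c v 5%N -> c u 6%N = c v 6%N -> c u 7%N = c v 7%N -> u = v.
Proof.
move=> c *; apply/rowP => k; rewrite -(inord_val k).
by case: k => [[|[|[|[|[|[|[|[|]]]]]]]]].
Qed.

Lemma row8E (s : seq F) k : (k < 8)%N -> row8 s 0 (inord k) = s`_k.
Proof. by move=> lt_k8; rewrite mxE inordK. Qed.

Lemma pmform8 (u v : 'rV[F]_8) : let c (w : 'rV[F]_8) (k : nat) : F := w 0 (inord k) in
  pmform u v = c u 0%N * c v 0%N + c u 1%N * c v 1%N + c u 2%N * c v 2%N + c u 3%N * c v 3%N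
             - c u 4%N * c v 4%N - c u 5%N * c v 5%N - c u 6%N * c v 6%N - c u 7%N * c v 7%N.
Proof.
move=> c; rewrite /pmform.
rewrite (eq_bigr (fun k : 'I_8 => (if (k < 4)%N then 1 else -1) * (c u k * c v k))).
  by rewrite !big_ord_recr big_ord0 /= !mul1r !mulN1r add0r.
by move=> k _; rewrite /c inord_val.
Qed.

Lemma row_mx48 (s : seq (seq F)) i : row i (mx48 s) = row8 (nth [::] s i).
Proof. by apply/rowP => k; rewrite !mxE. Qed.

Lemma mid_pmform (v : 'rV[F]_8) a b c d :
  pmform (mid a b c d) v = a * v 0 (inord 1) + b * v 0 (inord 2)
                         - c * v 0 (inord 5) - d * v 0 (inord 6).
Proof. by rewrite pmform8 !row8E //=; ring. Qed.

Section SelfOrthogonal.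
Variable R : {vspace 'rV[F]_8}.
Hypothesis R_assoc : (assoc_rels F <= R)%VS.
Hypothesis orthR : pmorth R = R.

Lemma assoc_mem : assoc_vdash F \in R /\ assoc_dashv F \in R.
Proof.
by split; apply: (subvP R_assoc); apply: memv_span; rewrite !inE eqxx ?orbT.
Qed.

Lemma self_orth0 u v : u \in R -> v \in R -> pmform u v = 0.
Proof. by move=> Ru; rewrite -[in _ \in _]orthR pmform_sym mul1r => /pmorthP->. Qed.

(** The form is negative on the last four coordinates, so pairing [v] with the two associativity
    relations gives v0 + v4 = 0 and v3 + v7 = 0. *)
Lemma assoc_coords v : v \in R ->
  v 0 (inord 4) = - v 0 (inord 0) /\ v 0 (inord 7) = - v 0 (inord 3).
Proof.
have [Rl Rr] := assoc_mem; move=> Rv.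
have := self_orth0 Rl Rv; have := self_orth0 Rr Rv.
rewrite !pmform8 !row8E //= => eq7 eq4; split; apply/eqP.
  by rewrite -addr_eq0 addrC -eq4; apply/eqP; ring.
by rewrite -addr_eq0 addrC -eq7; apply/eqP; ring.
Qed.

(** By [assoc_coords], subtracting v0 and v3 times the associativity relations clears coordinates 0,
    3, 4 and 7 at once. *)
Lemma mid_proj v : v \in R ->
  mid (v 0 (inord 1)) (v 0 (inord 2)) (v 0 (inord 5)) (v 0 (inord 6)) \in R.
Proof.
move=> Rv; have [Rl Rr] := assoc_mem; have [v4 v7] := assoc_coords Rv.
have -> : mid (v 0 (inord 1)) (v 0 (inord 2)) (v 0 (inord 5)) (v 0 (inord 6))
    = v - (v 0 (inord 0) *: assoc_vdash F + v 0 (inord 3) *: assoc_dashv F).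
  apply: row8P; rewrite /= row8E // !mxE ?inordK //= ?v4 ?v7; ring.
by rewrite memvB // memvD // memvZ.
Qed.

Lemma midD a b c d a' b' c' d' k : mid a b c d \in R -> mid a' b' c' d' \in R ->
  mid (a + k * a') (b + k * b') (c + k * c') (d + k * d') \in R.
Proof.
move=> Rm Rm'.
suff -> : mid (a + k * a') (b + k * b') (c + k * c') (d + k * d')
          = mid a b c d + k *: mid a' b' c' d' by rewrite memvD ?memvZ.
by apply: row8P; rewrite /= row8E // !mxE ?inordK //=; ring.
Qed.

Lemma midZ a b c d k : mid a b c d \in R ->
  mid (k * a) (k * b) (k * c) (k * d) \in R.
Proof.
(* Scaling by k is adding k - 1 times the vector to itself. *)
move=> Rm; have := midD (k - 1) Rm Rm.
by congr (is_true (mid _ _ _ _ \in R)); ring.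
Qed.

Lemma mid_pair a b c d a' b' c' d' : mid a b c d \in R -> mid a' b' c' d' \in R ->
  a * a' + b * b' = c * c' + d * d'.
Proof.
move=> Rm Rm'; have := self_orth0 Rm Rm'; rewrite mid_pmform !row8E //= => eq0.
by apply/eqP; rewrite -subr_eq0 -eq0; apply/eqP; ring.
Qed.

Lemma mx48_mem (r0 r1 r2 r3 : seq F) :
    row8 r0 \in R -> row8 r1 \in R -> row8 r2 \in R -> row8 r3 \in R ->
  forall i, row i (mx48 [:: r0; r1; r2; r3]) \in R.
Proof. by move=> R0 R1 R2 R3 i; rewrite row_mx48; case: i => [[|[|[|[|]]]]]. Qed.

End SelfOrthogonal.

Lemma sqr_eq_sign (x y : F) : x ^+ 2 = y ^+ 2 -> exists s : bool, x = (-1) ^+ s * y.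
Proof.
move/eqP; rewrite eqf_sqr => /orP[]/eqP->; [exists false | exists true].
  by rewrite mul1r.
by rewrite mulN1r.
Qed.

(** * Echelon form and isotropy of the two families *)

Lemma orthogonal_mx_rref (lam mu : F) s1 s2 s3 :
  row_free (orthogonal_mx lam mu s1 s2 s3) /\ is_rref (orthogonal_mx lam mu s1 s2 s3).
Proof.
pose piv (i : 'I_4) : 'I_8 := inord i.
have pivE (i : 'I_4) : piv i = i :> nat by rewrite inordK // (leq_trans (ltn_ord i)).
have mono (i i' : 'I_4) : (i < i')%N -> (piv i < piv i')%N by rewrite !pivE.
have M_piv i i' : orthogonal_mx lam mu s1 s2 s3 i (piv i') = (i == i')%:R.
  rewrite mxE pivE -val_eqE.
  by move: i i' => [[|[|[|[|?]]]] ?] [[|[|[|[|?]]]] ?].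
have M_lt i (k : 'I_8) : (k < piv i)%N -> orthogonal_mx lam mu s1 s2 s3 i k = 0.
  rewrite mxE pivE; move: i k => [[|[|[|[|?]]]] ?] [k lt_k] //=;
  by case: k lt_k => [|[|[|]]].
by split; [apply: pivots_row_free M_piv | apply: (pivots_rref mono M_piv M_lt)].
Qed.

Lemma isotropic_mx_rref (im : F) s1 s2 :
  row_free (isotropic_mx im s1 s2) /\ is_rref (isotropic_mx im s1 s2).
Proof.
pose piv (i : 'I_4) : 'I_8 := inord (nth 0 [:: 0; 1; 3; 5] i)%N.
have pivE (i : 'I_4) : piv i = nth 0 [:: 0; 1; 3; 5]%N i :> nat.
  by rewrite inordK //; case: i => [[|[|[|[|]]]]].
have mono (i i' : 'I_4) : (i < i')%N -> (piv i < piv i')%N.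
  by rewrite !pivE; move: i i' => [[|[|[|[|?]]]] ?] [[|[|[|[|?]]]] ?].
have M_piv i i' : isotropic_mx im s1 s2 i (piv i') = (i == i')%:R.
  rewrite mxE pivE -val_eqE.
  by move: i i' => [[|[|[|[|?]]]] ?] [[|[|[|[|?]]]] ?].
have M_lt i (k : 'I_8) : (k < piv i)%N -> isotropic_mx im s1 s2 i k = 0.
  rewrite mxE pivE; move: i k => [[|[|[|[|?]]]] ?] [k lt_k] //=;
  by case: k lt_k => [|[|[|[|[|]]]]].
by split; [apply: pivots_row_free M_piv | apply: (pivots_rref mono M_piv M_lt)].
Qed.

(** Rows 1 and 2 have norm 1 - lam^2 - mu^2 = 0, and the odd number of minus signs cancels their
    mutual pairing. *)
Lemma orthogonal_mx_isotropic (lam mu : F) s1 s2 s3 :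
    mu ^+ 2 = 1 - lam ^+ 2 -> s1 (+) s2 (+) s3 ->
  let M := orthogonal_mx lam mu s1 s2 s3 in
  forall i j, pmform (row i M) (row j M) = 0.
Proof.
move=> mu2 odd_s M i j; rewrite !row_mx48 pmform8 !row8E //.
move: i j => [[|[|[|[|?]]]] ?] [[|[|[|[|?]]]] ?] //=;
  case: s1 s2 s3 odd_s {M} => [] [] [] // _; rewrite ?expr1 ?expr0; ring: mu2.
Qed.

Lemma isotropic_mx_isotropic (im : F) s1 s2 : im ^+ 2 = -1 ->
  let M := isotropic_mx im s1 s2 in
  forall i j, pmform (row i M) (row j M) = 0.
Proof.
move=> im2 M i j; rewrite !row_mx48 pmform8 !row8E //.
move: i j => [[|[|[|[|?]]]] ?] [[|[|[|[|?]]]] ?] //=;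
  case: s1 s2 {M} => [] []; rewrite ?expr1 ?expr0; ring: im2.
Qed.

Lemma relation_matrix_self_orth R (M : 'M[F]_(4, 8)) :
    relation_matrix R M -> (forall i j, pmform (row i M) (row j M) = 0) ->
  pmorth R = R.
Proof. by case=> freeM _ defR; apply: isotropic_self_orth. Qed.

(** * Self-orthogonal R has a matrix in one of the families *)

Section RelationMatrices.
Variables (R : {vspace 'rV[F]_8}) (im : F) (sqrt : F -> F).
Hypothesis im_sq : im ^+ 2 = -1.
Hypothesis sqrt_sq : forall x : F, sqrt x ^+ 2 = x.
Hypothesis R_assoc : (assoc_rels F <= R)%VS.
Hypothesis orthR : pmorth R = R.

Lemma null_pair a b : a ^+ 2 + b ^+ 2 = 0 -> exists s : bool, b = (-1) ^+ s * im * a.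
Proof.
move=> ab0; have [|s ->] := @sqr_eq_sign b (im * a); last by exists s; rewrite mulrA.
by rewrite exprMn im_sq mulN1r; apply/eqP; rewrite -addr_eq0 addrC ab0.
Qed.

Lemma orthogonal_relations a b c d :
    mid 1 0 a b \in R -> mid 0 1 c d \in R ->
  exists (lam : F) (s1 s2 s3 : bool), s1 (+) s2 (+) s3 /\
    relation_matrix R (orthogonal_mx lam (sqrt (1 - lam ^+ 2)) s1 s2 s3).
Proof.
move=> R1 R2; have [Rl Rr] := assoc_mem R_assoc.
have n1 : a ^+ 2 + b ^+ 2 = 1 by have := mid_pair orthR R1 R1; rewrite !expr2 => <-; ring.
have n2 : c ^+ 2 + d ^+ 2 = 1 by have := mid_pair orthR R2 R2; rewrite !expr2 => <-; ring.
have n12 : a * c + b * d = 0 by have := mid_pair orthR R1 R2 => <-; ring.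
pose e := a * d - b * c.
(* The 2x2 matrix with rows (a, b) and (c, d) is orthogonal of determinant e,
   so that its inverse is at once its transpose and e times its adjugate. *)
have a_e : a = e * d.
  have -> : e * d = a * (c ^+ 2 + d ^+ 2) - c * (a * c + b * d) by rewrite /e; ring.
  by rewrite n2 n12; ring.
have b_e : b = - e * c.
  have -> : - e * c = b * (c ^+ 2 + d ^+ 2) - d * (a * c + b * d) by rewrite /e; ring.
  by rewrite n2 n12; ring.
have [|s1 def_e] := @sqr_eq_sign e 1.
  (* Lagrange's identity, which makes the determinant a square root of 1. *)
  have -> : e ^+ 2 = (a ^+ 2 + b ^+ 2) * (c ^+ 2 + d ^+ 2) - (a * c + b * d) ^+ 2.
    by rewrite /e; ring.
  by rewrite n1 n2 n12; ring.
have [|s3 def_c] := @sqr_eq_sign c (sqrt (1 - d ^+ 2)).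
  by rewrite sqrt_sq -n2; ring.
(* The lower right entry d is lam, and s1 is the sign of e. From b = - e c, the sign of b is
   opposite to the product of those of e and c, which fixes s2 and makes the parity odd. *)
exists d, s1, (~~ (s1 (+) s3)), s3; split; first by case: (s1) (s3) => [] [].
have [freeM rrefM] := orthogonal_mx_rref d (sqrt (1 - d ^+ 2)) s1 (~~ (s1 (+) s3)) s3.
split=> //; apply: self_orth_span => //; apply: mx48_mem => //; last by rewrite -def_c.
move: R1; rewrite a_e b_e def_e def_c; congr (is_true (mid _ _ _ _ \in R)).
  by rewrite mulr1.
by case: (s1) (s3) => [] []; rewrite /= ?expr1 ?expr0; ring.
Qed.

Lemma isotropic_relations v :
    v \in R -> v != 0 -> (forall k : 'I_8, (k < 4)%N -> v 0 k = 0) ->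
  exists s1 s2 : bool, relation_matrix R (isotropic_mx im s1 s2).
Proof.
move=> Rv v_neq0 v0; have [Rl Rr] := assoc_mem R_assoc.
have [v4 v7] := assoc_coords R_assoc orthR Rv.
have := mid_proj R_assoc orthR Rv.
have [v_0 v_1 v_2 v_3] : [/\ v 0 (inord 0) = 0, v 0 (inord 1) = 0,
    v 0 (inord 2) = 0 & v 0 (inord 3) = 0] by split; apply: v0; rewrite inordK.
rewrite v_1 v_2; set c := v 0 (inord 5); set d := v 0 (inord 6) => Rcd.
have cd0 : c ^+ 2 + d ^+ 2 = 0.
  by have := mid_pair orthR Rcd Rcd; rewrite !expr2 => <-; ring.
have [s2 def_d] := null_pair cd0.
have c_neq0 : c != 0.
  apply: contraNneq v_neq0 => c0; apply/eqP/row8P;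
    rewrite /= [RHS]mxE ?v4 ?v7 ?v_0 ?v_1 ?v_2 ?v_3 ?oppr0 //.
  by rewrite -/d def_d c0 mulr0.
(* Dividing the null vector (0, 0, c, d) by c gives the last row of the matrix. *)
have R2 : mid 0 0 1 ((-1) ^+ s2 * im) \in R.
  by have := midZ c^-1 Rcd; congr (is_true (mid _ _ _ _ \in R)); rewrite ?def_d; field.
have [s1 R1] : exists s1 : bool, mid 1 ((-1) ^+ s1 * im) 0 0 \in R.
  (* If (1, i, 0, 0) is not in R, which is its own complement, some [w] in R has a nonzero pairing a
     + i b with it; the other sign is then obtained from [w]. *)
  have [R1|] := boolP (mid 1 ((-1) ^+ false * im) 0 0 \in R); first by exists false.
  rewrite -{1}orthR => /mem_orthovPn[w Rw] /=; rewrite mid_pmform mul1r mul0r mul0r !subr0.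
  have := mid_proj R_assoc orthR Rw.
  set a := w 0 (inord 1); set b := w 0 (inord 2).
  set c' := w 0 (inord 5); set d' := w 0 (inord 6) => Rw' ab_neq0.
  have cd' : c' + (-1) ^+ s2 * im * d' = 0.
    by have := mid_pair orthR R2 Rw'; rewrite mul1r => <-; ring.
  (* Orthogonality to [R2] makes (c', d') equal to c' times (1, +-i), so subtracting c' times [R2]
     leaves (a, b, 0, 0), a null vector. *)
  have Rab : mid a b 0 0 \in R.
    have := midD (- c') Rw' R2; congr (is_true (mid _ _ _ _ \in R)); try ring.
    have -> : c' = - ((-1) ^+ s2 * im * d').
      by apply/eqP; rewrite -addr_eq0 cd'.
    by case: (s2); rewrite ?expr1 ?expr0; ring: im_sq.
  have ab0 : a ^+ 2 + b ^+ 2 = 0.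
    by have := mid_pair orthR Rab Rab; rewrite !expr2 => ->; ring.
  have [s1 def_b] := null_pair ab0; exists s1.
  have a_neq0 : a != 0.
    by apply: contraNneq ab_neq0 => a0; rewrite def_b a0 !mulr0 addr0.
  by have := midZ a^-1 Rab; congr (is_true (mid _ _ _ _ \in R)); rewrite ?def_b; field.
exists s1, s2; have [freeM rrefM] := isotropic_mx_rref im s1 s2.
by split=> //; apply: self_orth_span => //; apply: mx48_mem.
Qed.

Lemma self_orth_classification :
  (exists (lam : F) (s1 s2 s3 : bool),
      s1 (+) s2 (+) s3 /\
      relation_matrix R (orthogonal_mx lam (sqrt (1 - lam ^+ 2)) s1 s2 s3)) \/
  (exists s1 s2 : bool, relation_matrix R (isotropic_mx im s1 s2)).
Proof.
have [[v Rv [v_neq0 v0]]|surjR] := self_orth_first_half orthR; [right | left].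
  exact: isotropic_relations Rv v_neq0 v0.
have mid_basis (w : 'rV[F]_4) :
    exists c d, mid (w 0 (inord 1)) (w 0 (inord 2)) c d \in R.
  have [v Rv vw] := surjR w.
  exists (v 0 (inord 5)), (v 0 (inord 6)).
  have vE k : (k < 4)%N -> v 0 (inord k) = w 0 (inord k).
    move=> lt_k4; rewrite -vw; congr (v _ _); apply: val_inj.
    by rewrite /= !inordK // (leq_trans lt_k4).
  by rewrite -!vE // mid_proj.
(* Lifting the two middle basis vectors presents the plane as a graph over coordinates 1 and 2. *)
have [a [b]] := mid_basis (delta_mx 0 (inord 1)).
have [c [d]] := mid_basis (delta_mx 0 (inord 2)).
rewrite !mxE /= -!val_eqE /= !inordK //= => R2 R1.
exact: orthogonal_relations R1 R2.
Qed.

End RelationMatrices.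
End Classification.

Theorem theorem4p5 (F : closedFieldType) (charF0 : [pchar F] =i pred0)
    (im : F) (im_sq : im ^+ 2 = -1)
    (sqrt : F -> F) (sqrt_sq : forall x : F, sqrt x ^+ 2 = x)
    (R : {vspace 'rV[F]_8}) (R_assoc : (assoc_rels F <= R)%VS) :
  self_dual R <->
  (exists (lam : F) (s1 s2 s3 : bool),
      s1 (+) s2 (+) s3 /\
      relation_matrix R (orthogonal_mx lam (sqrt (1 - lam ^+ 2)) s1 s2 s3)) \/
  (exists s1 s2 : bool, relation_matrix R (isotropic_mx im s1 s2)).
Proof.
rewrite self_dualE; split; first exact: self_orth_classification.
case=> [[lam [s1 [s2 [s3 [odd_s relM]]]]]|[s1 [s2 relM]]];
  apply: (relation_matrix_self_orth relM).
  exact: orthogonal_mx_isotropic.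
exact: isotropic_mx_isotropic.
Qed.
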